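(* Let $m^2=0$ and let $\xi$ be one of the two values $\xi_+ = \frac16 + (1080)^{-1/2}$ or $\xi_- = \frac16 - (1080)^{-1/2}$. Then for every $\Lambda>0$ the de Sitter metric with cosmological constant $\Lambda$ solves the semi-classical Einstein equation $$G_{ab} + \Lambda g_{ab} = 8\pi G_{\rm N}\, \langle T_{ab}\rangle_{m=0,\xi},$$ where $\langle T_{ab}\rangle_{m=0,\xi}$ is the renormalised stress-energy tensor, in the Bunch-Davies vacuum, of the free massless Klein-Gordon field with curvature coupling $\xi$.
   Context: The $(3+1)$-dimensional de Sitter metric with cosmological constant $\Lambda>0$ is $g = \frac{3}{\Lambda\,\eta^2}\left(-d\eta^2+dx^2+dy^2+dz^2\right)$ (one half-line of $\eta\neq 0$); $G_{ab}=R_{ab}-\frac12 R g_{ab}$ is its Einstein tensor and $R$ its scalar curvature ($R=4\Lambda$). $G_{\rm N}>0$ is Newton's constant. The free Klein-Gordon field $\hat\Phi$ satisfies $(\Box - m^2-\xi R)\hat\Phi=0$, with $m^2\ge 0$ and $\xi\in\mathbb{R}$. The renormalised stress-energy tensor of this field in the Bunch-Davies vacuum on de Sitter spacetime is taken to be given by the formula $$\langle T_{ab}\rangle_{m,\xi} = \frac{g_{ab}}{(8\pi)^2}\Big\{ m^2\big[m^2+(\xi-\tfrac16)R\big]\big[\psi(\tfrac32+\nu)+\psi(\tfrac32-\nu)-\ln(12m^2/R)\big] - \tfrac12(\xi-\tfrac16)^2R^2 + \tfrac{R^2}{2160} - m^2(\xi-\tfrac16)R - \tfrac{m^2R}{18}\Big\}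 + \Theta_{ab},$$ where $\psi=\Gamma'/\Gamma$ is the digamma function, $\nu^2 = \frac94-12(m^2/R+\xi)$, and the ambiguity tensor is $\Theta_{ab} = -\alpha_\mu(\xi)\, m^2\Lambda\, g_{ab}/(8\pi)^2$ for a real function $\alpha_\mu$ of $\xi$. For $m^2=0$ all terms carrying a factor $m^2$ are zero, so that $$\langle T_{ab}\rangle_{m=0,\xi} = \frac{g_{ab}}{(8\pi)^2}\Big\{ -\tfrac12(\xi-\tfrac16)^2R^2+\tfrac{R^2}{2160}\Big\}.$$ *)

(* Defs.v *)
From HB Require Import structures.
From mathcomp Require Import all_boot all_order all_algebra.
From mathcomp Require Import complex.
From mathcomp Require Import all_classical all_reals all_analysis.
Set Implicit Arguments.
Unset Strict Implicit.
Unset Printing Implicit Defensive.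
Import Order.TTheory GRing.Theory Num.Theory.
Import numFieldNormedType.Exports.
Local Open Scope classical_set_scope.
Local Open Scope ring_scope.

(* Points of the coordinate chart are row vectors x = (eta, x, y, z); the
   conformal time eta is the coordinate of index 0.  A (0,2)-tensor field is the
   matrix-valued function of its components in this chart. *)

Definition partial (R : realType) (c : 'I_4) (f : 'rV[R]_4 -> R)
    (x : 'rV[R]_4) : R :=
  'D_(delta_mx 0 c) f x.

(* Gamma^a_{bc} *)
Definition christoffel (R : realType) (g : 'rV[R]_4 -> 'M[R]_4)
    (a b c : 'I_4) (x : 'rV[R]_4) : R :=
  2^-1 * \sum_(d < 4) invmx (g x) a d *
    (partial b (fun y => g y d c) x + partial c (fun y => g y d b) x
     - partial d (fun y => g y b c) x).

(* R_{bc} = R^a_{bac}; with this sign convention spheres, and de Sitter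
   spacetime in signature (-,+,+,+), have positive scalar curvature. *)
Definition ricci (R : realType) (g : 'rV[R]_4 -> 'M[R]_4)
    (x : 'rV[R]_4) : 'M[R]_4 :=
  \matrix_(b, c)
    ((\sum_(a < 4) partial a (christoffel g a b c) x)
     - (\sum_(a < 4) partial c (christoffel g a b a) x)
     + \sum_(a < 4) \sum_(d < 4)
         (christoffel g a a d x * christoffel g d b c x
          - christoffel g a c d x * christoffel g d b a x)).

Definition scalar_curvature (R : realType) (g : 'rV[R]_4 -> 'M[R]_4)
    (x : 'rV[R]_4) : R :=
  \sum_(a < 4) \sum_(b < 4) invmx (g x) a b * ricci g x a b.

Definition einstein_tensor (R : realType) (g : 'rV[R]_4 -> 'M[R]_4)
    (x : 'rV[R]_4) : 'M[R]_4 :=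
  ricci g x - (2^-1 * scalar_curvature g x) *: g x.

Definition minkowski (R : realType) : 'M[R]_4 :=
  \matrix_(a, b) (if a == b then if a == ord0 then -1 else 1 else 0).

Definition conformal_time (R : realType) (x : 'rV[R]_4) : R := x ord0 ord0.

(* Meaningful where conformal_time x != 0; either half-line may be used. *)
Definition de_sitter (R : realType) (Lambda : R) (x : 'rV[R]_4) : 'M[R]_4 :=
  (3 / (Lambda * conformal_time x ^+ 2)) *: minkowski R.

(* n ^ z = exp (z ln n) for a natural number n > 0 *)
Definition natr_cpow (R : realType) (n : nat) (z : R[i]) : R[i] :=
  let t := ln (n%:R : R) in
  Complex (expR (complex.Re z * t) * cos (complex.Im z * t))
          (expR (complex.Re z * t) * sin (complex.Im z * t)).

(* Gauss's limit for the Gamma function,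
     Gamma z = lim_n n! n^z / (z (z+1) ... (z+n)),
   valid for every complex z that is not a pole 0, -1, -2, ... *)
Definition complex_Gamma (R : realType) (z : R[i]^o) : R[i]^o :=
  lim ((fun n : nat => (n`!%:R * natr_cpow n z /
          \prod_(k < n.+1) ((z : R[i]) + k%:R)) : R[i]^o) @ \oo).

(* psi = Gamma' / Gamma, with the complex derivative *)
Definition digamma (R : realType) (z : R[i]) : R[i] :=
  (derive1 (@complex_Gamma R) z : R[i]) / (complex_Gamma z : R[i]).

(* nu is imaginary when 9/4 < 12 (m^2/R + xi).  The choice of square root is
   immaterial: nu enters only through psi (3/2 + nu) + psi (3/2 - nu). *)
Definition bd_nu (R : realType) (Rs m2 xi : R) : R[i] :=
  sqrtC (Complex (9 / 4 - 12 * (m2 / Rs + xi)) 0).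

(* This sum is real, since nu is real or imaginary. *)
Definition bd_psi_sum (R : realType) (Rs m2 xi : R) : R :=
  let nu := bd_nu Rs m2 xi in
  complex.Re (digamma (3 / 2 + nu) + digamma (3 / 2 - nu)).

(* Theta_{ab}; alpha stands for alpha_mu at a fixed scale mu. *)
Definition ambiguity_tensor (R : realType) (alpha : R -> R)
    (Lambda m2 xi : R) (x : 'rV[R]_4) : 'M[R]_4 :=
  - (alpha xi * m2 * Lambda / (8 * pi) ^+ 2) *: de_sitter Lambda x.

(* Renormalised stress-energy tensor <T_{ab}>_{m,xi} in the Bunch-Davies vacuum,
   as a function of m2 = m^2.  ln and bd_psi_sum are total (ln 0 = 0), so for m2 = 0
   every term carrying a factor m2 is 0, which is the massless convention. *)
Definition bd_stress_tensor (R : realType) (alpha : R -> R)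
    (Lambda m2 xi : R) (x : 'rV[R]_4) : 'M[R]_4 :=
  let Rs := scalar_curvature (de_sitter Lambda) x in
  ((m2 * (m2 + (xi - 6^-1) * Rs) * (bd_psi_sum Rs m2 xi - ln (12 * m2 / Rs))
    - 2^-1 * (xi - 6^-1) ^+ 2 * Rs ^+ 2
    + Rs ^+ 2 / 2160
    - m2 * (xi - 6^-1) * Rs
    - m2 * Rs / 18) / (8 * pi) ^+ 2) *: de_sitter Lambda x
  + ambiguity_tensor alpha Lambda m2 xi x.

Definition semiclassical_einstein (R : realType) (GN Lambda : R)
    (g T : 'rV[R]_4 -> 'M[R]_4) (D : set 'rV[R]_4) : Prop :=
  forall x, D x ->
    einstein_tensor g x + Lambda *: g x = (8 * pi * GN) *: T x.

(* Main.v *)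
(* De Sitter spacetime is an Einstein space with Ricci tensor Lambda g, so
   R = 4 Lambda and G + Lambda g = 0.  At xi - 1/6 = +- 1080^(-1/2) the two
   terms quadratic in R cancel, so the massless stress tensor vanishes too. *)

Require Import Defs.
From HB Require Import structures.
From mathcomp Require Import all_boot all_order all_algebra.
From mathcomp Require Import all_classical all_reals all_analysis.
From mathcomp Require Import ring.
Import Order.TTheory GRing.Theory Num.Theory.
Import numFieldNormedType.Exports.
Local Open Scope classical_set_scope.
Local Open Scope ring_scope.

(* The Christoffel symbols of the de Sitter metric are - ds_gamma / eta; the
   coefficients are integers so that contractions of them can be computed. *)
Definition ds_gamma (a b c : 'I_4) : int :=
  ((b == ord0) && (a == c))%:R + ((c == ord0) && (a == b))%:R
  + (a == ord0)%:R * (if b == c then if b == ord0 then -1 else 1 else 0).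

(** This is the Ricci tensor with its common factor [eta^-2] removed: differentiating
    [- ds_gamma / eta] gives [ds_gamma / eta^2] in the time direction only, and products of two
    symbols carry [eta^-2] as well. What remains is an integer identity, settled by evaluation at
    the 16 index pairs. *)
Lemma ds_gamma_contraction (b c : 'I_4) :
  \sum_a (a == ord0)%:R * ds_gamma a b c
  - \sum_a (c == ord0)%:R * ds_gamma a b a
  + \sum_a \sum_d (ds_gamma a a d * ds_gamma d b c
                    - ds_gamma a c d * ds_gamma d b a)
  = 3 * (if b == c then if b == ord0 then -1 else 1 else 0).
Proof.
rewrite !big_ord_recl !big_ord0.
by move: b c => [[|[|[|[|//]]]] ?] [[|[|[|[|//]]]] ?]; vm_compute.
Qed.

Section DeSitter.
Variable R : realType.
Implicit Types (x : 'rV[R]_4) (a b c : 'I_4) (L : R).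

(** A step [h] along the axis [c] shifts [eta] by [h] if [c] is the time index and by 0 otherwise,
    so both difference quotients coincide. This reduces every partial derivative below to one real
    variable. *)
Lemma partial_conformal_time (phi : R -> R) c x :
  partial c (fun y => phi (conformal_time y)) x =
  'D_((c == ord0)%:R : R) phi (conformal_time x).
Proof.
rewrite /partial /derive; set t := conformal_time x; set v := _%:R.
rewrite (_ : (fun h : R => _) =
  (fun h => h^-1 *: ((phi \o shift t) (h *: v) - phi t))) //.
by apply/funext => h /=; rewrite /t /v /conformal_time !mxE eqxx /= eq_sym.
Qed.

(** Used with [n = 1] for the metric components and [n = 0] for the Christoffel symbols. *)
Lemma derive_exprV (k : R) n (t v : R) : t != 0 ->
  'D_v (fun u : R => k * u^-1 ^+ n.+1) t = - (k * n.+1%:R * v * t^-1 ^+ n.+2).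
Proof.
move=> t0.
have dV : is_derive t v (fun u : R => u^-1) (- t ^- 2 *: v).
  exact: (@is_deriveV R id).
have dX := is_deriveZ k (is_deriveX n.+1 dV).
rewrite (_ : (fun _ : R => _) = k \*: (fun u : R => u^-1) ^+ n.+1); last first.
  by apply/funext => u; rewrite /= fctE.
rewrite (@derive_val _ _ _ _ _ _ _ dX) /GRing.scale /= -[t ^- 2]exprVn !exprS.
ring.
Qed.

Lemma near_conformal_time_neq0 x : conformal_time x != 0 ->
  \forall y \near x, conformal_time y != 0.
Proof.
move=> x0; apply: (@cvgr_neq0 _ _ _ (nbhs x) _ (@conformal_time R) (conformal_time x)) => //.
exact: coord_continuous.
Qed.

Lemma minkowski_sqr : Defs.minkowski R *m Defs.minkowski R = 1%:M.
Proof.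
apply/matrixP => a b; rewrite !mxE (bigD1 a) //= big1 => [|d da]; last first.
  by rewrite !mxE [a == d]eq_sym (negbTE da) mul0r.
rewrite !mxE eqxx addr0.
by case: eqP => // _; case: eqP => _; rewrite ?mulr0 ?mulrNN ?mulr1.
Qed.

Lemma invmx_de_sitter L x : L != 0 -> conformal_time x != 0 ->
  invmx (de_sitter L x) = (L * conformal_time x ^+ 2 / 3) *: Defs.minkowski R.
Proof.
move=> L0 x0; set B := RHS.
have AB : de_sitter L x *m B = 1%:M.
  rewrite -scalemxAl -scalemxAr minkowski_sqr scalerA.
  by rewrite (_ : _ * _ = 1) ?scale1r //; field; rewrite L0 x0.
have [Au _] := mulmx1_unit AB.
by rewrite -[LHS]mulmx1 -AB mulmxA mulVmx // mul1mx.
Qed.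

Lemma partial_de_sitter L x a b c : L != 0 -> conformal_time x != 0 ->
  partial c (fun y => de_sitter L y a b) x =
  - (c == ord0)%:R * (6 / (L * conformal_time x ^+ 3)) * Defs.minkowski R a b.
Proof.
move=> L0 x0.
under [X in partial _ X]eq_fun do rewrite mxE.
rewrite (partial_conformal_time
  (fun t : R => 3 / (L * t ^+ 2) * Defs.minkowski R a b)).
rewrite (_ : (fun t : R => _) =
    (fun t : R => 3 / L * Defs.minkowski R a b * t^-1 ^+ 2)); last first.
  by apply/funext => t; rewrite invfM exprVn; ring.
rewrite derive_exprV //; field.
by rewrite L0 x0.
Qed.

Lemma ds_gammaE a b c : (ds_gamma a b c)%:~R =
  ((b == ord0) && (a == c))%:R + ((c == ord0) && (a == b))%:R
  + (a == ord0)%:R * Defs.minkowski R b c.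
Proof.
rewrite /ds_gamma !rmorphD rmorphM !rmorph_nat mxE.
by congr (_ + _ * _); case: (b == c); case: (b == ord0).
Qed.

Lemma christoffel_de_sitter L x a b c : L != 0 -> conformal_time x != 0 ->
  christoffel (de_sitter L) a b c x =
  - (ds_gamma a b c)%:~R / conformal_time x.
Proof.
(* The inverse metric is diagonal, so only [d = a] contributes; the 64 index triples are then
   checked separately. *)
move=> L0 x0; rewrite /christoffel (bigD1 a) //= big1 => [|d da]; last first.
  by rewrite invmx_de_sitter // !mxE [a == d]eq_sym (negbTE da) mulr0 mul0r.
rewrite addr0 invmx_de_sitter // !partial_de_sitter // ds_gammaE !mxE eqxx.
move: a b c => [[|[|[|[|//]]]] ?] [[|[|[|[|//]]]] ?] [[|[|[|[|//]]]] ?];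
rewrite -!val_eqE /=; by field; rewrite L0 x0.
Qed.

Lemma partial_christoffel_de_sitter L x a b c d :
  L != 0 -> conformal_time x != 0 ->
  partial d (christoffel (de_sitter L) a b c) x =
  (d == ord0)%:R * (ds_gamma a b c)%:~R / conformal_time x ^+ 2.
Proof.
move=> L0 x0.
transitivity (partial d (fun y => - (ds_gamma a b c)%:~R * (conformal_time y)^-1) x).
  (* The closed form holds only off [eta = 0]; that set is open, so the two functions agree near
     [x], which determines the derivative. *)
  apply: near_eq_derive; near=> y; apply: christoffel_de_sitter => //.
  by near: y; exact: near_conformal_time_neq0.
rewrite (partial_conformal_time (fun t => - (ds_gamma a b c)%:~R * t^-1)).
by rewrite (derive_exprV _ 0) //; field.
Unshelve. all: end_near.
Qed.

Lemma ricci_de_sitter L x : L != 0 -> conformal_time x != 0 ->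
  ricci (de_sitter L) x = L *: de_sitter L x.
Proof.
move=> L0 x0; apply/matrixP => b c; rewrite !mxE.
set m := (if b == c then _ else _).
(* [L] cancels, which puts the target in the form of an integer over [eta^2], ready to be expanded
   by [ds_gamma_contraction]. *)
have -> : L * (3 / (L * conformal_time x ^+ 2) * m) =
    (3 * (if b == c then if b == ord0 then -1 else 1 else 0) : int)%:~R
    / conformal_time x ^+ 2.
  rewrite intrM (_ : (if _ then _ else _ : int)%:~R = m); last first.
    by rewrite /m; case: (b == c); case: (b == ord0).
  by field; rewrite L0 x0.
rewrite -ds_gamma_contraction rmorphD rmorphB !rmorph_sum !mulrDl mulNr.
rewrite !mulr_suml; congr (_ - _ + _).
- by apply: eq_bigr => a _; rewrite partial_christoffel_de_sitter // rmorphM rmorph_nat.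
- by apply: eq_bigr => a _; rewrite partial_christoffel_de_sitter // rmorphM rmorph_nat.
apply: eq_bigr => a _; rewrite rmorph_sum mulr_suml; apply: eq_bigr => d _.
by rewrite !christoffel_de_sitter // rmorphB !rmorphM; field.
Qed.

Lemma scalar_curvature_de_sitter L x : L != 0 -> conformal_time x != 0 ->
  scalar_curvature (de_sitter L) x = 4 * L.
Proof.
move=> L0 x0; rewrite /scalar_curvature ricci_de_sitter // invmx_de_sitter //.
rewrite !big_ord_recl !big_ord0 !mxE /=.
by field; rewrite L0 x0.
Qed.

Lemma einstein_tensor_de_sitter L x : L != 0 -> conformal_time x != 0 ->
  einstein_tensor (de_sitter L) x = - L *: de_sitter L x.
Proof.
move=> L0 x0; rewrite /einstein_tensor ricci_de_sitter //.
by rewrite scalar_curvature_de_sitter // -scalerBl; congr (_ *: _); field.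
Qed.

End DeSitter.

Lemma bd_stress_tensor_massless (R : realType) (alpha : R -> R) (L xi : R) x :
  (xi - 6^-1) ^+ 2 = 1080^-1 -> bd_stress_tensor alpha L 0 xi x = 0.
Proof.
move=> hxi; rewrite /bd_stress_tensor /ambiguity_tensor hxi.
(* The digamma and logarithm terms are multiplied by 0, so their values never have to be
   computed. *)
rewrite !(mul0r, mulr0) !oppr0 scale0r !addr0 add0r.
set S := scalar_curvature _ x.
(* Half of 1/1080 is 1/2160, so this is an identity in [S]. *)
rewrite (_ : - _ + S ^+ 2 / 2160 = 0) ?mul0r ?scale0r //.
by field.
Qed.

Theorem mainTheorem1 (R : realType) (GN : R) (hGN : 0 < GN)
    (alpha : R -> R) (m2 : R) (hm2 : m2 = 0) (xi : R)
    (hxi : xi = 6^-1 + 1080 `^ (- 2^-1) \/ xi = 6^-1 - 1080 `^ (- 2^-1)) :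
  forall Lambda : R, 0 < Lambda ->
    semiclassical_einstein GN Lambda (de_sitter Lambda)
      (bd_stress_tensor alpha Lambda m2 xi)
      [set x : 'rV[R]_4 | conformal_time x != 0].
Proof.
move=> L L0 x /= x0; rewrite hm2.
rewrite bd_stress_tensor_massless; last first.
  have E : ((1080 : R) `^ (- 2^-1)) ^+ 2 = 1080^-1.
    by rewrite -powR_mulrn ?powR_ge0 // -powRrM mulNr mulVf ?pnatr_eq0 // powR_inv1 ?ler0n.
  by case: hxi => ->; rewrite addrC addKr ?sqrrN; exact: E.
by rewrite einstein_tensor_de_sitter ?(lt0r_neq0 L0) // scaleNr addNr scaler0.
Qed.
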